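(* Let $X$ and $Y$ be real vector spaces. A mapping $f:X\to Y$ satisfies $$f(2x+y)+f(2x-y)=4[f(x+y)+f(x-y)]+2[f(2x)-4f(x)]-6f(y)$$ for all $x,y\in X$ if and only if there exist a unique symmetric multi-additive mapping $M:X^4\to Y$ and a unique symmetric bi-additive mapping $B:X\times X\to Y$ such that $$f(x)=M(x,x,x,x)+B(x,x)$$ for all $x\in X$.
   Context: A mapping $M:X^4\to Y$ is multi-additive if it is additive in each of its four variables when the other three are fixed, and symmetric if its value is invariant under all permutations of its arguments. A mapping $B:X\times X\to Y$ is bi-additive if it is additive in each of its two variables when the other is fixed, and symmetric if $B(x,y)=B(y,x)$ for all $x,y\in X$. Uniqueness means that there is exactly one pair $(M,B)$ of such mappings with $f(x)=M(x,x,x,x)+B(x,x)$ for all $x\in X$. *)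

(* Defs.v *)
From HB Require Import structures.
From mathcomp Require Import all_boot all_order all_algebra all_fingroup.
From mathcomp Require Import reals.

Set Implicit Arguments.
Unset Strict Implicit.
Unset Printing Implicit Defensive.

Import Order.TTheory GRing.Theory Num.Theory.
Local Open Scope ring_scope.

Definition quartic_quadratic_eq (R : realType) (X Y : lmodType R)
    (f : X -> Y) : Prop :=
  forall x y : X,
    f (2 *: x + y) + f (2 *: x - y)
    = 4 *: (f (x + y) + f (x - y)) + 2 *: (f (2 *: x) - 4 *: f x) - 6 *: f y.

Definition multi_additive4 (X Y : zmodType) (M : X -> X -> X -> X -> Y) : Prop :=
  [/\ forall y z w, {morph (fun x => M x y z w) : a b / a + b},
      forall x z w, {morph (fun y => M x y z w) : a b / a + b},
      forall x y w, {morph (fun z => M x y z w) : a b / a + b}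
    & forall x y z, {morph (fun w => M x y z w) : a b / a + b}].

(* The numerals 0, 1, 2, 3 below are the four elements of 'I_4, read through
   its ring structure. *)
Definition symmetric4 (X Y : Type) (M : X -> X -> X -> X -> Y) : Prop :=
  forall (s : 'S_4) (x : 'I_4 -> X),
    M (x (s 0)) (x (s 1)) (x (s 2)) (x (s 3)) = M (x 0) (x 1) (x 2) (x 3).

Definition bi_additive (X Y : zmodType) (B : X -> X -> Y) : Prop :=
  (forall y, {morph (fun x => B x y) : a b / a + b}) /\
  (forall x, {morph (fun y => B x y) : a b / a + b}).

Definition symmetric2 (X Y : Type) (B : X -> X -> Y) : Prop :=
  forall x y : X, B x y = B y x.

(* Main.v *)
(* Read at (x, y + 2x), the equation says that the fourth difference of f with
   step x does not depend on the base point y.  By polarization all mixed fifth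
   differences of f vanish, so M(x, y, z, w) = (1/24) D_x D_y D_z D_w f(0) is
   symmetric and multi-additive, and 12 M(x, x, x, x) = f(2x) - 4 f(x).  Then
   g(x) = f(x) - M(x, x, x, x) satisfies the equation and g(2x) = 4 g(x), so its
   fourth differences vanish; its third differences are then constant, and odd
   since g is even, hence zero, and B(x, y) = (1/2) D_x D_y g(0).  Uniqueness:
   comparing x with 2x separates the two diagonals, and polarization recovers
   M and B from them. *)
Require Import Defs.
From HB Require Import structures.
From mathcomp Require Import all_boot all_order all_algebra all_fingroup.
From mathcomp Require Import reals boolp ring.

Set Implicit Arguments.
Unset Strict Implicit.
Unset Printing Implicit Defensive.

Import Order.TTheory GRing.Theory Num.Theory.
Local Open Scope ring_scope.

(** * Deciding linear identities in modules *)

(* The square-zero extension R + V is a commutative ring, so linear identities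
   in the R-module V can be decided in it by [ring]. *)
Definition triv_ext (R : comNzRingType) (V : lmodType R) : Type := (R * V)%type.

Section TrivialExtension.
Variables (R : comNzRingType) (V : lmodType R).
Local Notation T := (triv_ext V).

HB.instance Definition _ := GRing.Zmodule.copy T (R * V)%type.

Definition te_one : T := (1, 0).
Definition te_mul (a b : T) : T := (a.1 * b.1, a.1 *: b.2 + b.1 *: a.2).

Fact te_mulA : associative te_mul.
Proof.
move=> [a u] [b v] [c w]; congr pair; rewrite /= ?mulrA //.
by rewrite !scalerDr !scalerA addrA (mulrC c a) (mulrC c b).
Qed.
Fact te_mulC : commutative te_mul.
Proof. by move=> [a u] [b v]; congr pair; rewrite /= 1?mulrC // addrC. Qed.
Fact te_mul1 : left_id te_one te_mul.
Proof.
by move=> [a u]; congr pair; rewrite /= ?mul1r // scale1r scaler0 addr0.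
Qed.
Fact te_mulDl : left_distributive te_mul +%R.
Proof.
move=> [a u] [b v] [c w]; congr pair; rewrite /= ?mulrDl //.
by rewrite scalerDl scalerDr addrACA.
Qed.
Fact te_one_neq0 : te_one != 0 :> T.
Proof. by apply/eqP => -[/eqP]; rewrite oner_eq0. Qed.

HB.instance Definition _ :=
  GRing.Zmodule_isComNzRing.Build T te_mulA te_mulC te_mul1 te_mulDl te_one_neq0.

Definition te_scalar (a : R) : T := (a, 0).
Definition te_vector (v : V) : T := (0, v).

Fact te_scalar_is_additive : zmod_morphism te_scalar.
Proof. by move=> a b; congr pair; rewrite /= subr0. Qed.
Fact te_scalar_is_multiplicative : monoid_morphism te_scalar.
Proof. by split=> // a b; congr pair; rewrite /= !scaler0 addr0. Qed.
HB.instance Definition _ :=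
  GRing.isZmodMorphism.Build R T te_scalar te_scalar_is_additive.
HB.instance Definition _ :=
  GRing.isMonoidMorphism.Build R T te_scalar te_scalar_is_multiplicative.

Fact te_vector_is_additive : zmod_morphism te_vector.
Proof. by move=> a b; congr pair; rewrite /= subr0. Qed.
HB.instance Definition _ :=
  GRing.isZmodMorphism.Build V T te_vector te_vector_is_additive.

Lemma te_vectorZ a v : te_vector (a *: v) = te_scalar a * te_vector v.
Proof. by congr pair; rewrite /= ?mulr0 // scaler0 addr0. Qed.

Lemma te_vectorD u v : te_vector (u + v) = te_vector u + te_vector v.
Proof. exact: raddfD. Qed.

Lemma te_vectorN v : te_vector (- v) = - te_vector v.
Proof. exact: raddfN. Qed.

Lemma te_vectorMn v n : te_vector (v *+ n) = te_vector v *+ n.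
Proof. exact: raddfMn. Qed.

Lemma te_vector0 : te_vector 0 = 0.
Proof. by []. Qed.

Definition te_vectorE :=
  (te_vectorZ, te_vectorD, te_vectorN, te_vectorMn, te_vector0).

Lemma te_vector_inj : injective te_vector.
Proof. by move=> u v []. Qed.
End TrivialExtension.

Ltac module := apply: te_vector_inj; rewrite ?te_vectorE /=; ring.

(** * Calculus of iterated finite differences *)

Section Differences.
Variables (R : realType) (V W : lmodType R).
Implicit Types (F G : V -> W) (a b x y : V) (s : seq V).

Definition diff a F : V -> W := fun y => F (y + a) - F y.

Definition diffs s F : V -> W := foldr diff F s.

Lemma diffC a b F : diff a (diff b F) = diff b (diff a F).
Proof. by apply/funext => y; rewrite /diff (addrAC y); module. Qed.

Lemma diffs_diff a s F : diffs s (diff a F) = diff a (diffs s F).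
Proof. by elim: s => //= b s ->; rewrite diffC. Qed.

Lemma diffs_perm s1 s2 F : perm_eq s1 s2 -> diffs s1 F = diffs s2 F.
Proof.
apply: (catCA_perm_subst (F := fun s => diffs s F)) => {}s1 {}s2 s3.
rewrite /diffs !foldr_cat; elim: s1 => //= a s1 ->.
by rewrite -[RHS]/(diffs s2 (diff a _)) diffs_diff.
Qed.

(* Substituting (y + n a, x - a) for (y, x) and subtracting kills the last term
   and turns the remaining [F k] into differences of [F k]. *)
Lemma diffs_of_sum_eq0 n (F : nat -> V -> W) :
    (forall x y, \sum_(k < n.+1) F k (y + x *+ k) = 0) ->
  forall s, size s = n -> diffs s (F 0%N) = fun=> 0.
Proof.
elim: n F => [|n IHn] F sumF0 [|a s] //= => [_ | [size_s]].
  by apply/funext => y; rewrite -(sumF0 0 y) big_ord1 mulr0n addr0.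
(* The term [F k] gets differenced with step [b *+ (n.+1 - k)]: this is [a] for [F 0], and zero for
   the last term. *)
pose b := n.+1%:R^-1 *: a.
have bE : b *+ n.+1 = a.
  by rewrite -scaler_nat scalerA divff ?scale1r ?pnatr_eq0.
rewrite -diffs_diff -bE.
apply: (IHn (fun k => diff (b *+ (n.+1 - k)) (F k))) => // x y.
have := subrr (0 : W).
rewrite -{1}(sumF0 (x - b) (y + b *+ n.+1)) -[X in _ - X](sumF0 x y).
apply: etrans.
rewrite sumrB !(big_ord_recr n.+1) /= mulrnBl (addrACA y) subrr addr0.
rewrite opprD addrACA subrr addr0.
congr (_ - _); apply: eq_bigr => k _; congr (F k _).
rewrite mulrnBl mulrnBr ?(ltnW (ltn_ord k)) //.
by module.
Qed.

Lemma diffs_const s F :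
  (forall a, diffs (a :: s) F = fun=> 0) -> forall y, diffs s F y = diffs s F 0.
Proof.
move=> diff0 y; apply/eqP; rewrite -subr_eq0; apply/eqP.
by have /(congr1 (@^~ 0)) := diff0 y; rewrite /= /diff add0r.
Qed.

(** For G = [diffs s F], D_{a+b} G(0) - D_a G(0) - D_b G(0) = D_a D_b G(0). *)
Lemma diffs_addl a b s F :
    (forall c, diffs (a :: c :: s) F = fun=> 0) ->
  diffs (a + b :: s) F 0 = diffs (a :: s) F 0 + diffs (b :: s) F 0.
Proof.
move=> diff0.
have /(congr1 (@^~ 0)) := diff0 b.
rewrite /= /diff !add0r => diffab0.
apply/eqP; rewrite -subr_eq0; apply/eqP; apply: etrans diffab0.
by module.
Qed.

(** Each difference flips the sign of a reflection symmetry and shifts its centre; three of them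
    make an even function odd about a point. *)
Lemma diff_reflect (c : V) (e : R) F a :
    (forall y, F (c - y) = e *: F y) ->
  forall y, diff a F (c - a - y) = - e *: diff a F y.
Proof.
move=> Fc y; rewrite /diff (_ : c - a - y + a = c - y); last by module.
by rewrite (_ : c - a - y = c - (y + a)) ?Fc ?Fc; module.
Qed.

End Differences.

(** * Polarization of symmetric bi- and multi-additive maps *)

Section Polarization.
Variables (R : realType) (V W : lmodType R).
Implicit Types (M : V -> V -> V -> V -> W) (B : V -> V -> W).

Lemma bi_additive_diagD B x y : bi_additive B -> symmetric2 B ->
  B (x + y) (x + y) = B x x + 2 *: B x y + B y y.
Proof. by move=> [BDl BDr] Bsym; rewrite BDl !BDr (Bsym y x); module. Qed.

Lemma morphD0 (h : V -> W) : {morph h : a b / a + b} -> h 0 = 0.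
Proof. by move=> hD; apply: (addrI (h 0)); rewrite -hD !addr0. Qed.

Lemma morphDN (h : V -> W) x : {morph h : a b / a + b} -> h (- x) = - h x.
Proof.
by move=> hD; apply: (addrI (h x)); rewrite -hD !subrr (morphD0 hD).
Qed.

Lemma bi_additive_diag0 B : bi_additive B -> symmetric2 B ->
  (forall x, B x x = 0) -> forall x y, B x y = 0.
Proof.
move=> Badd Bsym B0 x y; apply: (@scalerI _ _ 2); first by rewrite pnatr_eq0.
by have := bi_additive_diagD x y Badd Bsym; rewrite !B0 add0r addr0 scaler0.
Qed.

Lemma symmetric4_swap M : symmetric4 M ->
  [/\ forall x y z w, M x y z w = M y x z w,
      forall x y z w, M x y z w = M x z y w
    & forall x y z w, M x y z w = M x y w z].
Proof.
move=> Msym; split=> x y z w.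
- by have := Msym (tperm 0 1) (tnth [tuple y; x; z; w]); rewrite !permE.
- by have := Msym (tperm 1 2) (tnth [tuple x; z; y; w]); rewrite !permE.
- by have := Msym (tperm 2 3) (tnth [tuple x; y; w; z]); rewrite !permE.
Qed.

(** Terms odd in y cancel; 12 is twice the number of ways to place two x among four arguments. *)
Lemma multi_additive4_diag_sum M x y : multi_additive4 M -> symmetric4 M ->
  M (x + y) (x + y) (x + y) (x + y) + M (x - y) (x - y) (x - y) (x - y)
  = 2 *: M x x x x + 12 *: M x x y y + 2 *: M y y y y.
Proof.
move=> [D1 D2 D3 D4] /symmetric4_swap[S1 S2 S3].
have N1 a b c d : M (- a) b c d = - M a b c d.
  exact: (morphDN _ (D1 b c d)).
have N2 a b c d : M a (- b) c d = - M a b c d by rewrite S1 N1 S1.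
have N3 a b c d : M a b (- c) d = - M a b c d by rewrite S2 N2 S2.
have N4 a b c d : M a b c (- d) = - M a b c d by rewrite S3 N3 S3.
rewrite !D1 !D2 !D3 !D4 !(N1, N2, N3, N4).
(* Sort the arguments, x before y, so that equal terms become identical. *)
rewrite !(S3 _ _ y x) !(S2 _ y x) !(S1 y x)
  !(S3 _ _ y x) !(S2 _ y x) !(S3 _ _ y x).
by module.
Qed.

(** Vanishing spreads from M(x,x,x,x) to M(x,x,y,y), then to M(x,y,z,z) by polarizing the first two
    arguments, then to all of M by polarizing the last two. *)
Lemma multi_additive4_diag0 M : multi_additive4 M -> symmetric4 M ->
  (forall x, M x x x x = 0) -> forall x y z w, M x y z w = 0.
Proof.
move=> Madd Msym M0.
have [S1 S2 S3] := symmetric4_swap Msym; have [D1 D2 D3 D4] := Madd.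
have Mxxyy x y : M x x y y = 0.
  apply: (@scalerI _ _ 12); first by rewrite pnatr_eq0.
  have := multi_additive4_diag_sum x y Madd Msym.
  by rewrite !M0 !scaler0 !addr0 add0r => <-.
have Mxyzz x y z : M x y z z = 0.
  move: x y; apply: bi_additive_diag0 => [|x y|x]; last exact: Mxxyy.
    by split=> *; [exact: D1 | exact: D2].
  exact: S1.
move=> x y; apply: bi_additive_diag0 => [|z w|z]; last exact: Mxyzz.
  by split=> *; [exact: D3 | exact: D4].
exact: S3.
Qed.

Lemma bi_additive_of_sym B : symmetric2 B ->
  (forall y, {morph (fun x => B x y) : a b / a + b}) -> bi_additive B.
Proof. by move=> Bsym BD; split=> // x a b; rewrite !(Bsym x) BD. Qed.

Lemma multi_additive4_of_sym M : symmetric4 M ->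
  (forall y z w, {morph (fun x => M x y z w) : a b / a + b}) ->
  multi_additive4 M.
Proof.
move=> /symmetric4_swap[S1 S2 S3] D1.
have D2 x z w : {morph (fun y => M x y z w) : a b / a + b}.
  by move=> a b; rewrite !(S1 x) D1.
have D3 x y w : {morph (fun z => M x y z w) : a b / a + b}.
  by move=> a b; rewrite !(S2 x y) D2.
by split=> // x y z a b; rewrite !(S3 x y z) D3.
Qed.

Lemma quartic_quadratic_unique M B :
    symmetric4 M -> multi_additive4 M -> symmetric2 B -> bi_additive B ->
    (forall x, M x x x x + B x x = 0) ->
  (forall x y z w, M x y z w = 0) /\ (forall x y, B x y = 0).
Proof.
move=> Msym Madd Bsym Badd MB0.
have BE x : B x x = - M x x x x.
  by apply: (addrI (M x x x x)); rewrite MB0 subrr.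
have M0 x : M x x x x = 0.
  apply: (@scalerI _ _ 12); first by rewrite pnatr_eq0.
  have [D1 D2 D3 D4] := Madd.
  (* On the diagonal this reads 16 M + 4 B = 0, and B = -M leaves 12 M = 0. *)
  have := MB0 (x + x).
  rewrite (bi_additive_diagD x x Badd Bsym) BE !D1 !D2 !D3 !D4 scaler0.
  by move=> H; apply: etrans H; module.
split; first exact: multi_additive4_diag0.
by apply: bi_additive_diag0 => // x; rewrite BE M0 oppr0.
Qed.

End Polarization.

(** * Solutions of the functional equation *)

Section FunctionalEquation.
Variables (R : realType) (X Y : lmodType R).
Implicit Types (f g : X -> Y) (M : X -> X -> X -> X -> Y) (B : X -> X -> Y).

(** Extracts a = b from an instance u = v of an equation in which a - b occurs with coefficient c;
    what remains is a linear identity. *)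
Lemma eq_of_scaler (c : R) (a b u v : Y) :
  c != 0 -> u = v -> c *: a - c *: b = u - v -> a = b.
Proof.
move=> c_neq0 -> /eqP; rewrite subrr subr_eq0 => /eqP.
exact: scalerI.
Qed.

Lemma decomposition_quartic_quadratic_eq f M B :
    symmetric4 M -> multi_additive4 M -> symmetric2 B -> bi_additive B ->
  (forall x, f x = M x x x x + B x x) -> quartic_quadratic_eq f.
Proof.
move=> Msym Madd Bsym Badd fE x y; rewrite !fE.
have [D1 D2 D3 D4] := Madd; have [DB1 DB2] := Badd.
have BN u v : B u (- v) = - B u v by exact: (morphDN _ (DB2 u)).
have NB u v : B (- u) v = - B u v by rewrite Bsym BN Bsym.
(* Solved for the value at u - v, so that the values at u + v cancel. *)
have Msum u v := canRL (addKr _) (multi_additive4_diag_sum u v Madd Msym).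
have BD u v := bi_additive_diagD u v Badd Bsym.
rewrite !Msum !BD !NB !BN !opprK.
have -> : 2 *: x = x + x by module.
rewrite !(DB1 _ x x) !(DB2 _ x x) !(D1 _ _ _ x x) !(D2 _ _ _ x x).
by rewrite !(D3 _ _ _ x x) !(D4 _ _ _ x x); module.
Qed.

Lemma quartic_quadratic_eqB f g : quartic_quadratic_eq f ->
  quartic_quadratic_eq g -> quartic_quadratic_eq (fun x => f x - g x).
Proof.
move=> fE gE x y.
by rewrite (canRL (addKr _) (fE x y)) (canRL (addKr _) (gE x y)); module.
Qed.

(** The equation gives 6 f(0) = 0 at (0, 0), then 3 f(x) = 3 f(-x) at (0, x). *)
Lemma quartic_quadratic_eq_even f :
  quartic_quadratic_eq f -> forall x, f (- x) = f x.
Proof.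
move=> fE.
have f0 : f 0 = 0.
  apply: (eq_of_scaler (c := 6) _ (fE 0 0)); first by rewrite pnatr_eq0.
  by rewrite !scaler0 !subr0 !addr0; module.
move=> x; apply/esym/(eq_of_scaler (c := 3) _ (fE 0 x)).
  by rewrite pnatr_eq0.
by rewrite !scaler0 !add0r f0; module.
Qed.

Lemma diffs_nseq4 (F : X -> Y) x y :
  diffs (nseq 4 x) F y = F (y + x *+ 4) - 4 *: F (y + x *+ 3)
    + 6 *: F (y + x *+ 2) - 4 *: F (y + x) + F y.
Proof. by rewrite /= /diff !mulrS mulr0n addr0 !addrA; module. Qed.

Lemma quartic_quadratic_eq_diffs f : quartic_quadratic_eq f ->
  forall x y, diffs (nseq 4 x) f y = 2 *: (f (2 *: x) - 4 *: f x).
Proof.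
move=> fE x y; rewrite diffs_nseq4.
(* Evenness turns the arguments -y and -(y + x) into y and y + x, giving all five nodes of the
   fourth difference. *)
have := fE x (y + 2 *: x); have evf := quartic_quadratic_eq_even fE.
rewrite (_ : 2 *: x + _ = y + x *+ 4); last by module.
rewrite (_ : 2 *: x - _ = - y); last by module.
rewrite (_ : x + _ = y + x *+ 3); last by module.
rewrite (_ : x - _ = - (y + x)); last by module.
rewrite (_ : y + 2 *: x = y + x *+ 2); last by module.
rewrite !evf => /(canRL (addrK _)) ->; module.
Qed.

Lemma diffs4_eq0 (F : X -> Y) : (forall x, diffs (nseq 4 x) F = fun=> 0) ->
  forall s, size s = 4 -> diffs s F = fun=> 0.
Proof.
(* With these signed binomial coefficients the hypothesis is a relation between the F(y + kx). *)
move=> F0 s size_s; pose c : seq R := [:: 1; - 4; 6; - 4; 1].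
have := @diffs_of_sum_eq0 R X Y 4 (fun k y => c`_k *: F y) _ s size_s.
rewrite /= (_ : (fun y => 1 *: F y) = F); last first.
  by apply/funext => y; rewrite scale1r.
apply=> x y; rewrite !big_ord_recr big_ord0 /=.
apply: etrans (congr1 (@^~ y) (F0 x)); rewrite diffs_nseq4.
by rewrite mulr0n mulr1n addr0; module.
Qed.

(** Polarization applies to [diff a f]: its fourth differences with equal steps vanish, since those
    of f do not depend on the base point. *)
Lemma quartic_quadratic_eq_diffs5 f : quartic_quadratic_eq f ->
  forall a s, size s = 4 -> diffs (a :: s) f = fun=> 0.
Proof.
move=> fE a s size_s; rewrite /= -[LHS]/(diff a (diffs s f)) -diffs_diff.
apply: diffs4_eq0 => // x; apply/funext => y; rewrite diffs_diff /diff.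
by rewrite !quartic_quadratic_eq_diffs ?subrr.
Qed.

Lemma diffs_symmetric4 (F : X -> Y) (c : R) :
  symmetric4 (fun x y z w => c *: diffs [:: x; y; z; w] F 0).
Proof.
move=> s x; congr (_ *: _).
have enumE : enum 'I_4 = [:: 0; 1; 2; 3].
  by apply: (inj_map val_inj); rewrite val_enum_ord.
rewrite -[[:: x (s 0); _; _; _]]/(map (x \o s) [:: 0; 1; 2; 3]).
rewrite -[[:: x 0; _; _; _]]/(map x [:: 0; 1; 2; 3]) -enumE map_comp.
congr (_ 0); apply/diffs_perm/perm_map/uniq_perm; rewrite ?enum_uniq //.
  by rewrite (map_inj_uniq perm_inj) enum_uniq.
move=> i; rewrite mem_enum inE; apply/mapP; exists (s^-1%g i).
  by rewrite mem_enum.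
by rewrite permKV.
Qed.

Lemma quadratic_part g : quartic_quadratic_eq g ->
    (forall x, g (2 *: x) = 4 *: g x) ->
  exists B, [/\ symmetric2 B, bi_additive B & forall x, g x = B x x].
Proof.
move=> gE g2; have evg := quartic_quadratic_eq_even gE.
have diffs4 s : size s = 4 -> diffs s g = fun=> 0.
  apply: diffs4_eq0 => x; apply/funext => y.
  by rewrite quartic_quadratic_eq_diffs // g2 subrr scaler0.
(* Third differences of the even function [g] are both constant and odd. *)
have diffs3 a b c : diffs [:: a; b; c] g = fun=> 0.
  have const y : diffs [:: a; b; c] g y = diffs [:: a; b; c] g 0.
    by apply: diffs_const => d; apply: diffs4.
  apply/funext => y; rewrite const.
  have refl0 z : g (0 - z) = 1 *: g z by rewrite sub0r evg scale1r.
  have H : diffs [:: a; b; c] g (0 - c - b - a - 0)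
      = - - - 1 *: diffs [:: a; b; c] g 0.
    exact: (diff_reflect a (diff_reflect b (diff_reflect c refl0))).
  rewrite const in H.
  apply: (eq_of_scaler (c := 2) _ H); first by rewrite pnatr_eq0.
  by rewrite scaler0; module.
(* The factor comes from D_x D_x g(0) = g(2x) - 2 g(x) + g(0) = 2 g(x). *)
exists (fun x y => 2^-1 *: diffs [:: x; y] g 0).
have Bsym : symmetric2 (fun x y => 2^-1 *: diffs [:: x; y] g 0).
  by move=> x y; rewrite /= diffC.
split=> //.
  apply: bi_additive_of_sym => // y a b.
  by rewrite diffs_addl ?scalerDr // => c; exact: diffs3.
move=> x; apply: (@scalerI _ _ 2); first by rewrite pnatr_eq0.
rewrite scalerA divff ?pnatr_eq0 // scale1r /= /diff !add0r.
rewrite (_ : x + x = 2 *: x) ?g2; last by module.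
rewrite (_ : g 0 = 0); first by module.
apply: (eq_of_scaler (c := 3) _ (esym (g2 0))); first by rewrite pnatr_eq0.
by rewrite !scaler0; module.
Qed.

Lemma quartic_quadratic_decomposition f : quartic_quadratic_eq f ->
  exists M B, [/\ symmetric4 M, multi_additive4 M, symmetric2 B, bi_additive B
    & forall x, f x = M x x x x + B x x].
Proof.
move=> fE; pose M x y z w := 24^-1 *: diffs [:: x; y; z; w] f 0.
have Msym : symmetric4 M := diffs_symmetric4 f _.
have Madd : multi_additive4 M.
  apply: multi_additive4_of_sym => // y z w a b.
  rewrite /M diffs_addl ?scalerDr // => c.
  exact: quartic_quadratic_eq_diffs5.
have ME x : 12 *: M x x x x = f (2 *: x) - 4 *: f x.
  rewrite /M quartic_quadratic_eq_diffs // !scalerA.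
  by have -> : 12 * 24^-1 * 2 = 1 :> R; [field | rewrite scale1r].
have B0sym : symmetric2 (fun _ _ : X => 0 : Y) by [].
have B0add : bi_additive (fun _ _ : X => 0 : Y).
  by split=> *; move=> a b; rewrite addr0.
(* The converse direction with B = 0. *)
have DE : quartic_quadratic_eq (fun x => M x x x x).
  apply: (decomposition_quartic_quadratic_eq Msym Madd B0sym B0add) => x.
  by rewrite addr0.
have [|B [Bsym Badd gB]] := quadratic_part (quartic_quadratic_eqB fE DE).
  (* Subtracting 16 M(x,x,x,x) leaves 4 (f(x) - M(x,x,x,x)). *)
  move=> x /=; have -> : f (2 *: x) = 12 *: M x x x x + 4 *: f x.
    by rewrite ME subrK.
  have -> : 2 *: x = x + x by module.
  have [D1 D2 D3 D4] := Madd.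
  by rewrite !D1 !D2 !D3 !D4; module.
exists M, B; by split=> // x; rewrite -gB addrC subrK.
Qed.

End FunctionalEquation.

(** * Characterization by a unique decomposition *)

Theorem theorem2p2 (R : realType) (X Y : lmodType R) (f : X -> Y) :
  quartic_quadratic_eq f <->
  exists! MB : (X -> X -> X -> X -> Y) * (X -> X -> Y),
    let: (M, B) := MB in
    [/\ symmetric4 M, multi_additive4 M, symmetric2 B, bi_additive B
      & forall x : X, f x = M x x x x + B x x].
Proof.
split=> [fE | [[M B] [[Msym Madd Bsym Badd fMB] _]]]; last first.
  exact: decomposition_quartic_quadratic_eq fMB.
have [M [B [Msym Madd Bsym Badd fMB]]] := quartic_quadratic_decomposition fE.
exists (M, B); split=> // -[M' B'] [M'sym M'add B'sym B'add fMB'].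
(* The differences of two decompositions of f decompose the zero map. *)
pose dM x y z w := M x y z w - M' x y z w; pose dB x y := B x y - B' x y.
have dMsym : symmetric4 dM by move=> s x; rewrite /dM Msym M'sym.
have dBsym : symmetric2 dB by move=> x y; rewrite /dB Bsym B'sym.
have dMadd : multi_additive4 dM.
  have [[D1 _ _ _] [D1' _ _ _]] := (Madd, M'add).
  by apply: multi_additive4_of_sym => // y z w a b; rewrite /dM D1 D1'; module.
have dBadd : bi_additive dB.
  have [[D1 _] [D1' _]] := (Badd, B'add).
  by apply: bi_additive_of_sym => // y a b; rewrite /dB D1 D1'; module.
have [|dM0 dB0] := quartic_quadratic_unique dMsym dMadd dBsym dBadd.
  move=> x; rewrite -[RHS](subrr (f x)) {1}fMB fMB' /dM /dB; module.
congr pair.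
  apply/funext => x; apply/funext => y; apply/funext => z; apply/funext => w.
  exact: subr0_eq (dM0 x y z w).
by apply/funext => x; apply/funext => y; exact: subr0_eq (dB0 x y).
Qed.
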